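(* Assume (A1) and (A2). Let $(t_0,x_0)\in(0,T)\times\mathbb R^n$, let $p_0=\sigma_y(y)\in\ell(t_0,x_0)$ with $y\in\ell^*(t_0,x_0)$, and let $$\mathcal C:\ x=x(t)=x_0+\int_{t_0}^tH_p(\tau,p_0)\,d\tau,\qquad t\in[0,T],$$ be the corresponding characteristic curve of type (I) at $(t_0,x_0)$. Then for all $(t,x)\in\mathcal C$ with $0\le t\le t_0$ one has $p_0\in\ell(t,x)$ and, moreover, $\ell(t,x)\subset\ell(t_0,x_0)$.
   Context: Let $T>0$ and $\Omega=(0,T)\times\mathbb R^n$. Let $H=H(t,p)$ be a real-valued function of class $C^1$ on $[0,T]\times\mathbb R^n$ and $\sigma:\mathbb R^n\to\mathbb R$ be convex and of class $C^1$. $\sigma^*:\mathbb R^n\to\mathbb R\cup\{+\infty\}$ is the Fenchel conjugate of $\sigma$; $H_p$ is the gradient of $H$ in $p$ and $\sigma_y$ the gradient of $\sigma$. Condition (A1): for every $(t_0,x_0)\in[0,T)\times\mathbb R^n$ there exist positive constants $r$ and $N$ such that $$\langle x,p\rangle-\sigma^*(p)-\int_0^tH(\tau,p)\,d\tau<\max_{|q|\le N}\Big\{\langle x,q\rangle-\sigma^*(q)-\int_0^tH(\tau,q)\,d\tau\Big\}$$ whenever $(t,x)\in[0,T)\times\mathbb R^n$, $|t-t_0|+|x-x_0|<r$ and $|p|>N$. Condition (A2): $H$ has one of the two following forms: a) $H(t,\cdot)$ is convex for all $t\in(0,T)$, or $H(t,\cdot)$ is concave for all $t\in(0,T)$; b)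 $H(t,p)=g(t)h(p)+k(t)$ for some functions $g,h,k$, where $g(t)$ does not change its sign on $(0,T)$. For $(t,x)\in[0,T)\times\mathbb R^n$, $\ell(t,x)$ is the set of all $p\in\mathbb R^n$ at which the function $q\mapsto\langle x,q\rangle-\sigma^*(q)-\int_0^tH(\tau,q)\,d\tau$ attains its maximum over $\mathbb R^n$. For $y\in\mathbb R^n$, the characteristic curve emanating from $(0,y)$ is $x=y+\int_0^tH_p(\tau,\sigma_y(y))\,d\tau$, $t\in[0,T]$. For $(t_0,x_0)\in\Omega$, $\ell^*(t_0,x_0)$ is the set of all $y$ such that the characteristic curve emanating from $(0,y)$ passes through $(t_0,x_0)$; this curve can then be written $x=x_0+\int_{t_0}^tH_p(\tau,\sigma_y(y))\,d\tau$. Such a characteristic curve (with $y\in\ell^*(t_0,x_0)$) is of type (I) at $(t_0,x_0)$ if $\sigma_y(y)\in\ell(t_0,x_0)$. ''$(t,x)\in\mathcal C$'' means $x=x(t)$. *)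

(* Defs.v *)
From HB Require Import structures.
From mathcomp Require Import all_boot all_order all_algebra.
From mathcomp Require Import all_classical all_reals all_analysis.

Set Implicit Arguments.
Unset Strict Implicit.
Unset Printing Implicit Defensive.

Import Order.TTheory GRing.Theory Num.Theory.
Import numFieldNormedType.Exports.

Local Open Scope classical_set_scope.
Local Open Scope ring_scope.

Definition dot (R : realType) (n : nat) (x p : 'rV[R]_n) : R :=
  \sum_(i < n) x ord0 i * p ord0 i.

(* The library norm `|x| on 'rV[R]_n is the sup norm, hence a separate
   Euclidean norm. *)
Definition enorm (R : realType) (n : nat) (x : 'rV[R]_n) : R :=
  Num.sqrt (dot x x).

Definition grad (R : realType) (n : nat) (f : 'rV[R]_n -> R) (p : 'rV[R]_n) :
    'rV[R]_n :=
  \row_(i < n) 'D_(delta_mx ord0 i) f p.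

Definition C1 (R : realType) (n : nat) (f : 'rV[R]_n -> R) : Prop :=
  (forall p i, derivable f p (delta_mx ord0 i)) /\ continuous (grad f).

(* Class C^1 on the closed slab [0,T] x R^n: all first-order partial
   derivatives exist and are jointly continuous on the slab, the derivative in
   t being taken relative to [0,T] (so it is one-sided at 0 and at T).  The
   values H t p with t outside [0,T] are irrelevant. *)
Definition C1_slab (R : realType) (n : nat) (T : R)
    (H : R -> 'rV[R]_n -> R) : Prop :=
  let D := [set z : R * 'rV[R]_n | 0 <= z.1 <= T] in
  [/\ forall t p i, 0 <= t <= T -> derivable (H t) p (delta_mx ord0 i),
      {within D, continuous (fun z => grad (H z.1) z.2)} &
      exists Ht : R * 'rV[R]_n -> R,
        {within D, continuous Ht} /\
        forall t p, 0 <= t <= T ->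
          (H s p - H t p) / (s - t) @[s --> within `[0, T] t^'] --> Ht (t, p)].

(* Oriented integral from a to b, negative of the one from b to a if b < a. *)
Definition oint (R : realType) (a b : R) (f : R -> R) : R :=
  if a <= b then \int[lebesgue_measure]_(s in `[a, b]) f s
  else - \int[lebesgue_measure]_(s in `[b, a]) f s.

Definition oint_rV (R : realType) (n : nat) (a b : R) (F : R -> 'rV[R]_n) :
    'rV[R]_n :=
  \row_(i < n) oint a b (fun s => F s ord0 i).

Definition fenchel (R : realType) (n : nat) (sigma : 'rV[R]_n -> R)
    (p : 'rV[R]_n) : \bar R :=
  ereal_sup [set (dot y p - sigma y)%:E | y in [set: 'rV[R]_n]].

Definition convex_rV (R : realType) (n : nat) (f : 'rV[R]_n -> R) : Prop :=
  convex_function [set: convex_lmodType 'rV[R]_n] f.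

Definition concave_rV (R : realType) (n : nat) (f : 'rV[R]_n -> R) : Prop :=
  convex_rV (fun p => - f p).

(* Equal to -oo exactly where the conjugate of sigma is +oo. *)
Definition hopf (R : realType) (n : nat) (H : R -> 'rV[R]_n -> R)
    (sigma : 'rV[R]_n -> R) (t : R) (x q : 'rV[R]_n) : \bar R :=
  ((dot x q)%:E - fenchel sigma q - (oint 0 t (fun s => H s q))%:E)%E.

Definition argmax (R : realType) (U : Type) (A : set U) (f : U -> \bar R) :
    set U :=
  [set p | A p /\ forall q, A q -> (f q <= f p)%E].

Definition condA1 (R : realType) (n : nat) (T : R) (H : R -> 'rV[R]_n -> R)
    (sigma : 'rV[R]_n -> R) : Prop :=
  forall (t0 : R) (x0 : 'rV[R]_n), 0 <= t0 < T ->
  exists r N : R, [/\ 0 < r, 0 < N &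
    forall (t : R) (x p : 'rV[R]_n), 0 <= t < T ->
      `|t - t0| + enorm (x - x0) < r -> N < enorm p ->
      exists2 q, argmax [set q | enorm q <= N] (hopf H sigma t x) q &
        (hopf H sigma t x p < hopf H sigma t x q)%E].

Definition condA2a (R : realType) (n : nat) (T : R) (H : R -> 'rV[R]_n -> R) :
    Prop :=
  (forall t, 0 < t < T -> convex_rV (H t)) \/
  (forall t, 0 < t < T -> concave_rV (H t)).

Definition condA2b (R : realType) (n : nat) (T : R) (H : R -> 'rV[R]_n -> R) :
    Prop :=
  exists (g : R -> R) (h : 'rV[R]_n -> R) (k : R -> R),
    (forall t p, 0 < t < T -> H t p = g t * h p + k t) /\
    ((forall t, 0 < t < T -> 0 <= g t) \/ (forall t, 0 < t < T -> g t <= 0)).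

Definition condA2 (R : realType) (n : nat) (T : R) (H : R -> 'rV[R]_n -> R) :
    Prop :=
  condA2a T H \/ condA2b T H.

Definition ell (R : realType) (n : nat) (H : R -> 'rV[R]_n -> R)
    (sigma : 'rV[R]_n -> R) (t : R) (x : 'rV[R]_n) : set 'rV[R]_n :=
  argmax [set: 'rV[R]_n] (hopf H sigma t x).

(* The curve t |-> a + \int_s^t H_p(tau, p) dtau, at a when t = s. *)
Definition curve (R : realType) (n : nat) (H : R -> 'rV[R]_n -> R)
    (s : R) (a p : 'rV[R]_n) (t : R) : 'rV[R]_n :=
  a + oint_rV s t (fun tau => grad (H tau) p).

Definition ell_star (R : realType) (n : nat) (H : R -> 'rV[R]_n -> R)
    (sigma : 'rV[R]_n -> R) (t0 : R) (x0 : 'rV[R]_n) : set 'rV[R]_n :=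
  [set y | curve H 0 y (grad sigma y) t0 = x0].

(* Main.v *)
(* Let B_s(q) = H(s,q) - H(s,p0) - <H_p(s,p0), q - p0>.  Along the curve, the
   Hopf function of (t, x(t)) at q exceeds its value at p0 by

     [<y, q> - sigma(y) - sigma^*(q)] - \int_0^t B_s(q) ds,

   where the bracket is <= 0 and, sigma being differentiable, vanishes only at
   q = p0.  By (A2), for each fixed q the sign of B_s(q) does not depend on s.
   If B_s(q) >= 0, the excess is <= 0 with equality only at q = p0; if
   B_s(q) <= 0, the excess is nondecreasing in t, hence bounded by its value at
   t0, which is <= 0 and whose vanishing means q in ell(t0, x0). *)
Require Import Defs.
From HB Require Import structures.
From mathcomp Require Import all_boot all_order all_algebra.
From mathcomp Require Import all_classical all_reals all_analysis.
From mathcomp Require Import ring lra.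

Set Implicit Arguments.
Unset Strict Implicit.
Unset Printing Implicit Defensive.

Import Order.TTheory GRing.Theory Num.Theory.
Import numFieldNormedType.Exports.

Local Open Scope classical_set_scope.
Local Open Scope ring_scope.

(** * Bilinearity of the Euclidean inner product *)

Section Dot.
Context (R : realType) (n : nat).
Implicit Types x y z : 'rV[R]_n.

Lemma dotC x y : dot x y = dot y x.
Proof. by apply: eq_bigr => i _; rewrite mulrC. Qed.

Lemma dotDl x y z : dot (x + y) z = dot x z + dot y z.
Proof. by rewrite -big_split; apply: eq_bigr => i _; rewrite mxE mulrDl. Qed.

Lemma dotZl (c : R) x y : dot (c *: x) y = c * dot x y.
Proof. by rewrite mulr_sumr; apply: eq_bigr => i _; rewrite mxE mulrA. Qed.

Lemma dotNl x y : dot (- x) y = - dot x y.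
Proof. by rewrite -scaleN1r dotZl mulN1r. Qed.

Lemma dotDr x y z : dot z (x + y) = dot z x + dot z y.
Proof. by rewrite dotC dotDl !(dotC z). Qed.

Lemma dotNr x y : dot y (- x) = - dot y x.
Proof. by rewrite dotC dotNl dotC. Qed.

Lemma dot_delta x i : dot x (delta_mx ord0 i) = x ord0 i.
Proof.
rewrite /dot (bigD1 i)//= big1 ?addr0 => [|j ji]; rewrite !mxE ?eqxx ?mulr1//.
by rewrite (negPf ji) mulr0.
Qed.

End Dot.

(** * Gradient inequalities obtained from partial derivatives alone *)

Section Convex.
Context (R : realType) (n : nat).
Implicit Types (f : 'rV[R]_n -> R) (p q v : 'rV[R]_n).

Lemma convex_rV_le f (a b : R) p q : convex_rV f -> 0 <= a -> 0 <= b ->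
  a + b = 1 -> f (a *: p + b *: q) <= a * f p + b * f q.
Proof.
move=> cf a0 b0 ab1; have a1 : a <= 1 by lra.
have := cf (Itv01 a0 a1) p q; rewrite !inE => /(_ Logic.I Logic.I).
by rewrite convRE /conv/= /unstable.onem; have -> : 1 - a = b by lra.
Qed.

(** The limit of difference quotients is cleared of its denominator, so that [h = 0] and both signs
    of [h] are covered. *)
Lemma partial_expansion f p i (eta : R) :
  derivable f p (delta_mx ord0 i) -> 0 < eta ->
  exists2 delta : R, 0 < delta & forall h : R, `|h| < delta ->
    `|f (p + h *: delta_mx ord0 i) - f p - h * grad f p ord0 i| <= eta * `|h|.
Proof.
move=> df eta0; rewrite mxE.
move/cvgrPdist_le: df => /(_ _ eta0).
rewrite near_withinE => /nbhs_ballP[d /= d0 dP]; exists d => // h hd.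
have [->|h0] := eqVneq h 0.
  by rewrite scale0r addr0 subrr mul0r subrr normr0 mulr0.
have := dP h; rewrite /ball/= sub0r normrN => /(_ hd h0) /=.
rewrite /shift/= [h *: _ + p]addrC.
set D := lim _; set E := _ - f p => H.
have -> : E - h * 'D_(delta_mx ord0 i) f p = - (h * (D - h^-1 *: E)).
  by rewrite -/D mulrBr /GRing.scale/= mulVKf// opprB.
by rewrite normrN normrM mulrC ler_wpM2r.
Qed.

(* [l] bounds from above the upper right Dini derivative of [f] at [p] in the
   direction [v]; for convex [f] this is additive in [(v, l)]. *)
Definition dini_le f p v (l : R) := forall eta : R, 0 < eta ->
  exists2 delta : R, 0 < delta & forall e : R, 0 < e < delta ->
    f (p + e *: v) - f p <= e * (l + eta).

Lemma dini_le0 f p : dini_le f p 0 0.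
Proof.
move=> eta eta0; exists 1 => // e /andP[e0 _].
by rewrite scaler0 addr0 subrr add0r mulr_ge0 ?ltW.
Qed.

(** [p + e *: (v + w)] is the midpoint of [p + (e * 2) *: v] and [p + (e * 2) *: w], so convexity
    applies; the doubled step is why [delta] is halved. *)
Lemma dini_leD f p v w (l m : R) : convex_rV f ->
  dini_le f p v l -> dini_le f p w m -> dini_le f p (v + w) (l + m).
Proof.
move=> cf fv fw eta eta0; have eta2 : 0 < eta / 2 by rewrite divr_gt0.
have [d1 d10 h1] := fv _ eta2; have [d2 d20 h2] := fw _ eta2.
exists (Num.min d1 d2 / 2) => [|e]; first by rewrite divr_gt0// lt_min d10.
rewrite ltr_pdivlMr// lt_min => /and3P[e0 ed1 ed2].
have /h1 {}h1 : 0 < e * 2 < d1 by rewrite ed1 andbT; lra.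
have /h2 {}h2 : 0 < e * 2 < d2 by rewrite ed2 andbT; lra.
have -> : p + e *: (v + w) =
    2^-1 *: (p + (e * 2) *: v) + 2^-1 *: (p + (e * 2) *: w).
  by apply/rowP => i; rewrite !mxE; field.
have half0 : 0 <= 2^-1 :> R by lra.
have halves : 2^-1 + 2^-1 = 1 :> R by lra.
have := convex_rV_le (p + (e * 2) *: v) (p + (e * 2) *: w) cf half0 half0 halves.
by move: h1 h2; lra.
Qed.

Lemma dini_le_partial f p i (c : R) : derivable f p (delta_mx ord0 i) ->
  dini_le f p (c *: delta_mx ord0 i) (c * grad f p ord0 i).
Proof.
move=> df eta eta0; have c1 : 0 < `|c| + 1 by rewrite ltr_wpDl.
(* With this tolerance the error at step [e * c] is at most [e * eta]; the [+ 1] keeps the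
   denominator positive when [c = 0]. *)
have [|d d0 hd] := partial_expansion df (_ : 0 < eta / (`|c| + 1)).
  by rewrite divr_gt0.
exists (d / (`|c| + 1)) => [|e /andP[e0]]; first by rewrite divr_gt0.
rewrite ltr_pdivlMr// => ed.
have ece : `|e * c| < d.
  rewrite normrM gtr0_norm//; apply: le_lt_trans ed.
  by rewrite ler_pM2l// lerDl.
have := hd _ ece; rewrite scalerA => /(le_trans (ler_norm _)) {}hd.
have : eta / (`|c| + 1) * `|e * c| <= e * eta.
  rewrite normrM gtr0_norm// mulrCA ler_pM2l// mulrAC ler_pdivrMr//.
  by rewrite ler_pM2l// lerDl.
move: hd; rewrite mulrDr mulrA; lra.
Qed.

(** Summing the partial derivatives over the coordinates bounds the growth of [f] from [p] in the
    direction [p - q], away from [q]. Since [p] lies between [p + e *: (p - q)] and [q], convexity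
    turns this upper bound into a lower bound at [q]. *)
Lemma convex_grad_le f p q : convex_rV f ->
  (forall i, derivable f p (delta_mx ord0 i)) ->
  f p + dot (grad f p) (q - p) <= f q.
Proof.
move=> cf df; have : dini_le f p (p - q) (- dot (grad f p) (q - p)).
  rewrite -dotNr opprB dotC; set v := p - q; rewrite {1}(row_sum_delta v).
  apply: (big_ind2 (dini_le f p)) => [|u l w m|i _]; first exact: dini_le0.
    exact: dini_leD.
  exact: dini_le_partial.
move=> dpq; apply/ler_addgt0Pr => eta eta0; have [d d0 {}dpq] := dpq _ eta0.
have e0 : 0 < d / 2 by rewrite divr_gt0.
have /dpq {dpq} : 0 < d / 2 < d by rewrite e0/=; lra.
move: (d / 2) e0 => e e0 h.
have e1 : 1 + e != 0 by lra.
have a0 : 0 <= (1 + e)^-1 by rewrite invr_ge0; lra.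
have b0 : 0 <= e / (1 + e) by rewrite divr_ge0//; lra.
have ab1 : (1 + e)^-1 + e / (1 + e) = 1 by field.
have := convex_rV_le (p + e *: (p - q)) q cf a0 b0 ab1.
have -> : (1 + e)^-1 *: (p + e *: (p - q)) + (e / (1 + e)) *: q = p.
  by apply/rowP => i; rewrite !mxE; field.
(* Clearing denominators gives [(1 + e) * f p <= f (p + e *: (p - q)) + e * f q]. *)
rewrite -(@ler_pM2l _ (1 + e)); last by lra.
rewrite mulrDr mulVKf// mulrA (mulrC (1 + e) (e / _)) divfK// => h2.
rewrite -(@ler_pM2l _ e)//; lra.
Qed.

(** Testing the subgradient inequality at small steps of both signs along each axis squeezes every
    coordinate of [q] onto the partial derivative. *)
Lemma subgradient_grad f p q : (forall i, derivable f p (delta_mx ord0 i)) ->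
  (forall z, f p + dot q (z - p) <= f z) -> q = grad f p.
Proof.
move=> df sq; apply/rowP => i.
have step (eta : R) : 0 < eta -> exists2 h : R, 0 < h &
    h * q ord0 i <= h * (grad f p ord0 i + eta) /\
    h * grad f p ord0 i <= h * (q ord0 i + eta).
  move=> eta0; have [d d0 hd] := partial_expansion (df i) eta0.
  have h0 : 0 < d / 2 by rewrite divr_gt0.
  have hh : `|d / 2| < d by rewrite gtr0_norm//; lra.
  have hhN : `|- (d / 2)| < d by rewrite normrN.
  move: (hd _ hh) (hd _ hhN) (sq (p + (d / 2) *: delta_mx ord0 i))
    (sq (p + (- (d / 2)) *: delta_mx ord0 i)).
  rewrite normrN (gtr0_norm h0) !ler_norml !(addrC p) !addrK.
  rewrite !(dotC q) !dotZl !(dotC _ q) !dot_delta; move: (d / 2) h0 => h h0.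
  move=> /andP[_ h1] /andP[_ h2] h3 h4; exists h => //; move: h1 h2 h3 h4; lra.
by apply/eqP; rewrite eq_le; apply/andP; split; apply/ler_addgt0Pr => eta eta0;
  have [h h0 [h1 h2]] := step _ eta0; rewrite -(ler_pM2l h0).
Qed.

End Convex.

(** * The conjugate at a gradient, and the equality case of Fenchel-Young *)

Section Fenchel.
Context (R : realType) (n : nat) (sigma : 'rV[R]_n -> R) (y : 'rV[R]_n).
Context (sigma_convex : convex_rV sigma)
  (dsigma : forall i, derivable sigma y (delta_mx ord0 i)).

Lemma fenchel_young q : ((dot y q - sigma y)%:E <= fenchel sigma q)%E.
Proof. by apply: ereal_sup_ubound; exists y. Qed.

(** The gradient inequality at [y] says that the supremum defining the conjugate is attained
    there. *)
Lemma fenchel_grad :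
  fenchel sigma (grad sigma y) = (dot y (grad sigma y) - sigma y)%:E.
Proof.
apply/le_anti/andP; split; last exact: fenchel_young.
apply: ge_ereal_sup => _ [z _ <-]; rewrite lee_fin.
have := convex_grad_le z sigma_convex dsigma.
rewrite dotDr dotNr (dotC _ z) (dotC _ y); lra.
Qed.

(** Equality in Fenchel-Young makes [q] a subgradient of [sigma] at [y], and the partial derivatives
    leave only the gradient. *)
Lemma fenchel_young_eq q :
  (fenchel sigma q <= (dot y q - sigma y)%:E)%E -> q = grad sigma y.
Proof.
move=> hq; apply: subgradient_grad dsigma _ => z.
have : ((dot z q - sigma z)%:E <= (dot y q - sigma y)%:E)%E.
  by apply: le_trans hq; apply: ereal_sup_ubound; exists z.
rewrite lee_fin dotDr dotNr !(dotC q); lra.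
Qed.

End Fenchel.

(** * Sign, additivity and linearity of oriented integrals *)

Section Oint.
Context (R : realType).
Notation mu := (@lebesgue_measure R).
Implicit Types (f : R -> R) (a b t : R).

(** The left endpoint is negligible. Leaving it out matters because (A2) constrains [H] only at
    times in the open interval from 0 to [T], while the integrals start at 0. *)
Lemma oint_ge0 f a b : a <= b -> mu.-integrable `[a, b] (EFin \o f) ->
  (forall s, a < s <= b -> 0 <= f s) -> 0 <= oint a b f.
Proof.
move=> ab fi f0; rewrite /oint ab -Rintegral_itv_obnd_cbnd.
  by apply: Rintegral_ge0 => s /=; rewrite in_itv/=; exact: f0.
by apply: integrableS fi => //; apply: subset_itvr; rewrite bnd_simp.
Qed.

Lemma ointC f a b : oint b a f = - oint a b f.
Proof.
rewrite /oint; case: ltgtP => [ab|ab|->]; rewrite ?opprK//.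
by rewrite set_itv1 Rintegral_set1 oppr0.
Qed.

Lemma ointB_le f a b t : a <= t <= b -> mu.-integrable `[a, b] (EFin \o f) ->
  oint a b f - oint a t f = oint t b f.
Proof.
move=> /andP[at_ tb] fi; rewrite /oint at_ tb (le_trans at_ tb).
rewrite Rintegral_itvB ?bnd_simp// Rintegral_itv_obnd_cbnd//.
by apply: integrableS fi => //; apply: subset_itvr; rewrite bnd_simp.
Qed.

Lemma ointD f g a b : a <= b -> mu.-integrable `[a, b] (EFin \o f) ->
  mu.-integrable `[a, b] (EFin \o g) ->
  oint a b (f \+ g) = oint a b f + oint a b g.
Proof. by move=> ab fi gi; rewrite /oint ab RintegralD. Qed.

Lemma ointZ f a b (c : R) : a <= b -> mu.-integrable `[a, b] (EFin \o f) ->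
  oint a b (c \*o f) = c * oint a b f.
Proof. by move=> ab fi; rewrite /oint ab -RintegralZl. Qed.

Lemma oint_le0 f a b : a <= b -> mu.-integrable `[a, b] (EFin \o f) ->
  (forall s, a < s <= b -> f s <= 0) -> oint a b f <= 0.
Proof.
move=> ab fi f0; rewrite -oppr_ge0 -mulN1r -ointZ//; apply: oint_ge0 => //.
  exact: (integrableZl _ (-1) fi).
by move=> s /f0; rewrite /= mulN1r oppr_ge0.
Qed.

(** Integrability and value are proved together: additivity at each induction step requires the tail
    to be integrable. This lets the inner product with a fixed vector commute with the integral. *)
Lemma integrable_lincomb (I : Type) (r : seq I) (F : I -> R -> R) (c : I -> R)
    a b : a <= b -> (forall i, mu.-integrable `[a, b] (EFin \o F i)) ->
  mu.-integrable `[a, b] (EFin \o (fun s => \sum_(i <- r) c i * F i s)) /\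
  oint a b (fun s => \sum_(i <- r) c i * F i s)
    = \sum_(i <- r) c i * oint a b (F i).
Proof.
move=> ab Fi; elim: r => [|i r [IHi IHo]].
  have -> : (fun s => \sum_(i <- [::]) c i * F i s) = cst 0.
    by apply/funext => s; rewrite big_nil.
  rewrite big_nil.
  split; first exact: integrable0.
  by rewrite /oint ab /Rintegral integral0.
rewrite big_cons -IHo -ointZ//.
have -> : (fun s => \sum_(j <- i :: r) c j * F j s) =
    (c i \*o F i) \+ (fun s => \sum_(j <- r) c j * F j s).
  by apply/funext => s; rewrite big_cons.
have Zi : mu.-integrable `[a, b] (EFin \o (c i \*o F i)).
  exact: (integrableZl _ (c i) (Fi i)).
split; first exact: (integrableD _ Zi IHi).
exact: ointD.
Qed.

End Oint.

(** * Continuity in time of [H] and of its spatial gradient *)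

Section Slab.
Context (R : realType) (n : nat) (T : R) (H : R -> 'rV[R]_n -> R).
Context (H_C1 : C1_slab T H).
Notation mu := (@lebesgue_measure R).

Lemma slab_continuous q : {within `[0, T], continuous (H ^~ q)}.
Proof.
have [_ _ [Ht [_ dH]]] := H_C1.
apply/subspace_continuousP => t /=; rewrite in_itv/= => tT.
have cH : H s q @[s --> within `[0, T] t^'] --> H t q.
  (* Differentiability gives continuity: [H s q] is [H t q] plus the difference quotient times
     [s - t], and the limit is put in the same form. *)
  have {1}-> : H t q = H t q + Ht (t, q) * (t - t) by rewrite subrr mulr0 addr0.
  apply: (@cvg_trans _ (H t q + (H s q - H t q) / (s - t) * (s - t)
      @[s --> within `[0, T] t^'])).
    apply: near_eq_cvg; apply: (@nearW _ (nbhs t)) => s st _.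
    by rewrite divfK ?subr_eq0// addrC subrK.
  apply: cvgD; first exact: cvg_cst.
  apply: cvgM; first exact: dH.
  apply: cvgB; last exact: cvg_cst.
  apply: cvg_trans (cvg_within _) _.
  exact: cvg_within.
(* The limit above is over punctured neighbourhoods; the point [s = t] is added by hand. *)
move=> B Bt.
suff : nbhs t [set s | s \in `[0, T] -> B (H s q)] by [].
have : nbhs t [set s | s != t -> s \in `[0, T] -> B (H s q)] by exact: cH.
apply: filterS => s /= Bs sT.
by have [->|st] := eqVneq s t; [exact: nbhs_singleton|exact: Bs].
Qed.

Lemma slab_grad_continuous p i :
  {within `[0, T], continuous (fun s => grad (H s) p ord0 i)}.
Proof.
have [_ + _] := H_C1; move=> /subspace_continuousP cg.
apply/subspace_continuousP => t /= tT.
have tT' : 0 <= t <= T by move: tT; rewrite in_itv.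
apply: (@cvg_comp _ _ _ (fun s => grad (H s) p) (fun M => M ord0 i) _
   (nbhs (grad (H t) p))); last exact: coord_continuous.
move=> B Bt; change (nbhs t [set s | s \in `[0, T] -> B (grad (H s) p)]).
have [[U V] [/= Ut Vp] UVB] := cg (t, p) tT' B Bt.
apply: filterS Ut => s Us sT; apply: (UVB (s, p)) => /=.
  by split=> //; exact: nbhs_singleton.
by move: sT; rewrite in_itv.
Qed.

End Slab.

(** * Bregman divergences and their sign under (A2) *)

Definition bregman (R : realType) (n : nat) (f : 'rV[R]_n -> R)
  (p q : 'rV[R]_n) : R := f q - f p - dot (grad f p) (q - p).

Lemma convex_bregman_ge0 (R : realType) (n : nat) (f : 'rV[R]_n -> R) p q :
  convex_rV f -> (forall i, derivable f p (delta_mx ord0 i)) ->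
  0 <= bregman f p q.
Proof. by move=> cf df; have := convex_grad_le q cf df; rewrite /bregman; lra. Qed.

Lemma concave_bregman_le0 (R : realType) (n : nat) (f : 'rV[R]_n -> R) p q :
  concave_rV f -> (forall i, derivable f p (delta_mx ord0 i)) ->
  bregman f p q <= 0.
Proof.
move=> cf df; have dNf i : derivable (- f) p (delta_mx ord0 i).
  exact: derivableN.
have := convex_bregman_ge0 q cf dNf; rewrite /bregman.
have -> : grad (- f) p = - grad f p by apply/rowP => i; rewrite !mxE deriveN.
rewrite dotNl; lra.
Qed.

Lemma bregman_affine (R : realType) (n : nat) (f h : 'rV[R]_n -> R)
    (c d : R) p q :
  (forall i, derivable h p (delta_mx ord0 i)) ->
  (forall z, f z = c * h z + d) -> bregman f p q = c * bregman h p q.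
Proof.
move=> dh fE; rewrite /bregman !fE; have -> : grad f p = c *: grad h p.
  have -> : f = c \*: h + cst d by apply/funext => z; rewrite fE.
  apply/rowP => i; rewrite !mxE deriveD; last 2 first.
  - exact: derivableZ.
  - exact: derivable_cst.
  by rewrite derive_cst addr0 deriveZ.
by rewrite dotZl; ring.
Qed.

(** In the separated form the divergence of [H t] is [g t] times that of [h]: the second factor does
    not depend on [t] and the first keeps its sign. Which alternative holds may depend on [q]. *)
Lemma bregman_sign (R : realType) (n : nat) (T : R) (H : R -> 'rV[R]_n -> R)
    p q :
  (forall t i, 0 < t < T -> derivable (H t) p (delta_mx ord0 i)) ->
  condA2 T H ->
  (forall t, 0 < t < T -> 0 <= bregman (H t) p q) \/
  (forall t, 0 < t < T -> bregman (H t) p q <= 0).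
Proof.
move=> dH [[cH|cH]|[g [h [k [HE gsign]]]]].
- by left=> t tT; apply: convex_bregman_ge0 => [|i]; [exact: cH|exact: dH].
- by right=> t tT; apply: concave_bregman_le0 => [|i]; [exact: cH|exact: dH].
have [[t1 t1T g1]|g0] := pselect (exists2 t1, 0 < t1 < T & g t1 != 0); last first.
  left=> t tT; have gt0 : g t = 0.
    by apply/eqP/negPn/negP => gt; apply: g0; exists t.
  (* When [g] vanishes throughout, nothing is known about the derivability of [h], so [cst 0] takes
     its place. *)
  have -> : bregman (H t) p q = 0 * bregman (cst 0) p q; last by rewrite mul0r.
  apply: (bregman_affine (d := k t)) => [i|z]; first exact: derivable_cst.
  by rewrite HE// gt0 !mul0r.
have dh i : derivable h p (delta_mx ord0 i).
  (* A single time with [g t1 != 0] suffices to recover [h], and its partial derivatives at [p],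
     from [H t1]. *)
  have -> : h = (g t1)^-1 \*: (H t1 - cst (k t1)).
    by apply/funext => z; rewrite !fctE /= HE// addrK /GRing.scale/= mulKf.
  by apply: derivableZ; apply: derivableB; [exact: dH|exact: derivable_cst].
have bE t : 0 < t < T -> bregman (H t) p q = g t * bregman h p q.
  by move=> tT; apply: bregman_affine => [//|z]; rewrite HE.
case: gsign => gs; case: (lerP 0 (bregman h p q)) => [b0|/ltW b0].
- by left=> t tT; rewrite bE// mulr_ge0// gs.
- by right=> t tT; rewrite bE// mulr_ge0_le0// gs.
- by right=> t tT; rewrite bE// mulr_le0_ge0// gs.
- by left=> t tT; rewrite bE// mulr_le0// gs.
Qed.

(** * The Hopf function along a characteristic curve *)

Section Characteristic.
Context (R : realType) (n : nat) (T : R) (H : R -> 'rV[R]_n -> R).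
Context (H_C1 : C1_slab T H).
Notation mu := (@lebesgue_measure R).

Lemma slab_integrable q t : t <= T ->
  mu.-integrable `[0, t] (EFin \o (H ^~ q)).
Proof.
move=> tT; apply: continuous_compact_integrable; first exact: segment_compact.
have/continuous_subspaceW := slab_continuous H_C1 (q := q); apply.
by apply: subset_itvl; rewrite bnd_simp.
Qed.

Lemma slab_grad_integrable p i t : t <= T ->
  mu.-integrable `[0, t] (EFin \o (fun s => grad (H s) p ord0 i)).
Proof.
move=> tT; apply: continuous_compact_integrable; first exact: segment_compact.
have/continuous_subspaceW := slab_grad_continuous H_C1 (p := p) (i := i); apply.
by apply: subset_itvl; rewrite bnd_simp.
Qed.

Lemma oint_bregman p q t : 0 <= t <= T ->
  mu.-integrable `[0, t] (EFin \o (fun s => bregman (H s) p q)) /\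
  oint 0 t (fun s => bregman (H s) p q) =
  oint 0 t (H ^~ q) - oint 0 t (H ^~ p)
    - dot (oint_rV 0 t (fun s => grad (H s) p)) (q - p).
Proof.
move=> /andP[t0 tT]; set v := q - p.
have [gi go] := integrable_lincomb (index_enum 'I_n) (fun i => v ord0 i) t0
  (fun i => slab_grad_integrable p i tT).
have iq := slab_integrable q tT; have ip := slab_integrable p tT.
have -> : (fun s => bregman (H s) p q) =
    (H ^~ q) \+ (-1 \*o ((H ^~ p) \+
      (fun s => \sum_i v ord0 i * grad (H s) p ord0 i))).
  apply/funext => s; rewrite /bregman /dot/= mulN1r opprD addrA.
  by congr (_ - _); apply: eq_bigr => i _; rewrite mulrC.
set g := (fun s => \sum_i _) in gi go *.
have ipg : mu.-integrable `[0, t] (EFin \o ((H ^~ p) \+ g)).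
  exact: (integrableD _ ip gi).
have iN : mu.-integrable `[0, t] (EFin \o (-1 \*o ((H ^~ p) \+ g))).
  exact: (integrableZl _ (-1) ipg).
split; first exact: (integrableD _ iq iN).
rewrite ointD// ointZ// ointD// go mulN1r opprD addrA; congr (_ - _).
by rewrite dotC /dot; apply: eq_bigr => i _; rewrite [oint_rV _ _ _ _ _]mxE.
Qed.

(** Identifies the curve anchored at its later point with the one emanating from [y] at time 0; the
    integral from [s] back to [t] is negatively oriented. *)
Lemma curve_concat s t y p : 0 <= t <= s -> s <= T ->
  curve H s (curve H 0 y p s) p t = curve H 0 y p t.
Proof.
move=> ts sT; apply/rowP => i; rewrite !mxE -addrA; congr (_ + _).
rewrite (ointC _ t s) -(ointB_le ts (slab_grad_integrable p i sT)).
by rewrite subKr.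
Qed.

(** Pairing the displacement of the curve with [q - p] supplies exactly the linear term of the
    divergence. The conjugate stays outside the real part since it may be infinite. *)
Lemma hopfE (sigma : 'rV[R]_n -> R) y p q t : 0 <= t <= T ->
  hopf H sigma t (curve H 0 y p t) q =
  ((dot (curve H 0 y p t) p - oint 0 t (H ^~ p) + dot y (q - p)
    - oint 0 t (fun s => bregman (H s) p q))%:E - fenchel sigma q)%E.
Proof.
move=> tT; rewrite /hopf addeAC -EFinB; congr (_%:E - _)%E.
have [_ ->] := oint_bregman p q tT.
by rewrite /curve !dotDl !dotDr !dotNr; ring.
Qed.

Lemma oint_bregman_dichotomy p q t0 : condA2 T H -> 0 < t0 < T ->
  (forall t, 0 <= t <= t0 -> 0 <= oint 0 t (fun s => bregman (H s) p q)) \/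
  (forall t, 0 <= t <= t0 -> oint 0 t0 (fun s => bregman (H s) p q) <=
                             oint 0 t (fun s => bregman (H s) p q)).
Proof.
move=> A2 /andP[t00 t0T]; have [dH _ _] := H_C1.
have bi t : 0 <= t <= T ->
    mu.-integrable `[0, t] (EFin \o (fun s => bregman (H s) p q)).
  by move=> /(oint_bregman p q)[].
have [|b0|b0] := bregman_sign (p := p) q _ A2.
- by move=> t i /andP[/ltW ? /ltW ?]; apply: dH; apply/andP.
- left=> t /andP[tge0 tt0]; apply: oint_ge0 => //.
    by apply: bi; rewrite tge0 (le_trans tt0)// ltW.
  move=> s /andP[s0 st]; apply: b0; rewrite s0.
  by rewrite (le_lt_trans st)// (le_lt_trans tt0).
(* The difference of the two integrals is the integral from [t] to [t0] of a nonpositive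
   function. *)
right=> t tt0; have bi0 := bi t0; rewrite -subr_le0 (ointB_le tt0); last first.
  by apply: bi; rewrite !ltW.
move: tt0 => /andP[tge0 tt0]; apply: oint_le0 => //.
  apply: integrableS (bi t0 _) => //; last by rewrite !ltW.
  by apply: subset_itvr; rewrite bnd_simp.
move=> s /andP[ts st0]; apply: b0.
by rewrite (le_lt_trans tge0 ts) (le_lt_trans st0).
Qed.

End Characteristic.

Theorem theorem2p9 (R : realType) (n : nat) (T : R) (T_gt0 : 0 < T)
    (H : R -> 'rV[R]_n -> R) (sigma : 'rV[R]_n -> R)
    (H_C1 : C1_slab T H) (sigma_convex : convex_rV sigma) (sigma_C1 : C1 sigma)
    (A1 : condA1 T H sigma) (A2 : condA2 T H)
    (t0 : R) (x0 : 'rV[R]_n) (t0_bounds : 0 < t0 < T)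
    (y p0 : 'rV[R]_n) (p0E : p0 = grad sigma y)
    (p0_ell : ell H sigma t0 x0 p0) (y_ell_star : ell_star H sigma t0 x0 y) :
  forall (t : R) (x : 'rV[R]_n), 0 <= t <= t0 -> x = curve H t0 x0 p0 t ->
    ell H sigma t x p0 /\ ell H sigma t x `<=` ell H sigma t0 x0.
Proof.
have [t0_gt0 t0T] := andP t0_bounds; have [dsigma _] := sigma_C1.
have t00 : 0 <= t0 <= t0 by rewrite lexx ltW.
(* Comparing the Hopf function at [q] and at [p0] along the curve amounts to comparing [G t q] with
   the conjugate at [q]. *)
pose G t q := dot y q - sigma y - oint 0 t (fun s => bregman (H s) p0 q).
have tT t : 0 <= t <= t0 -> 0 <= t <= T.
  by move=> /andP[-> tt0]; rewrite (le_trans tt0) ?ltW.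
have hopf_p0 t : 0 <= t <= t0 -> hopf H sigma t (curve H 0 y p0 t) p0 =
    (dot (curve H 0 y p0 t) p0 - oint 0 t (H ^~ p0) - dot y p0 + sigma y)%:E.
  move=> _; rewrite /hopf [in fenchel _ _]p0E fenchel_grad// -p0E -!EFinB.
  by congr EFin; ring.
have hopf_le t q : 0 <= t <= t0 ->
    (hopf H sigma t (curve H 0 y p0 t) q <= hopf H sigma t (curve H 0 y p0 t) p0)%E
    = ((G t q)%:E <= fenchel sigma q)%E.
  move=> tt0; rewrite hopf_p0// (hopfE H_C1) ?tT// /G dotDr dotNr.
  (* For an infinite conjugate both comparisons have the same truth value; only the finite case
     needs arithmetic. *)
  case: (fenchel sigma q) => [u||] //=; rewrite ?leNye ?leey//.
  by rewrite -!EFinB !lee_fin; apply/idP/idP; lra.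
have hopf_ge t q : 0 <= t <= t0 ->
    (hopf H sigma t (curve H 0 y p0 t) p0 <= hopf H sigma t (curve H 0 y p0 t) q)%E
    = (fenchel sigma q <= (G t q)%:E)%E.
  move=> tt0; rewrite hopf_p0// (hopfE H_C1) ?tT// /G dotDr dotNr.
  case: (fenchel sigma q) => [u||] //=; rewrite ?leNye ?leey//.
  by rewrite -!EFinB !lee_fin; apply/idP/idP; lra.
move: y_ell_star p0_ell; rewrite /ell_star /= -p0E => <- [_ p0_max] t x tt0.
rewrite (curve_concat H_C1 _ _ tt0 (ltW t0T)) => ->.
have G_max q : ((G t0 q)%:E <= fenchel sigma q)%E.
  by rewrite -hopf_le//; exact: p0_max.
(* The first half is the maximality of [p0] at time [t]; the second carries a tie with [p0] from
   time [t] to time [t0]. *)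
have key q : ((G t q)%:E <= fenchel sigma q)%E /\
    ((fenchel sigma q <= (G t q)%:E)%E -> (fenchel sigma q <= (G t0 q)%:E)%E).
  have [b0|b0] := oint_bregman_dichotomy H_C1 p0 q A2 t0_bounds.
    have Gle : ((G t q)%:E <= (dot y q - sigma y)%:E)%E.
      by rewrite lee_fin /G gerBl b0.
    split; first exact: le_trans Gle (fenchel_young _ _ _).
    (* A tie forces equality in Fenchel-Young, hence [q = p0], and the claim at [t0] compares [p0]
       with itself. *)
    move=> /le_trans/(_ Gle)/(fenchel_young_eq (dsigma y)).
    by rewrite -p0E => ->; rewrite -hopf_ge.
  have Gle : ((G t q)%:E <= (G t0 q)%:E)%E by rewrite lee_fin lerB// b0.
  by split=> [|/le_trans]; [exact: le_trans Gle (G_max _)|exact].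
split; first by split=> // q _; rewrite hopf_le//; case: (key q).
(* A maximiser [q] at time [t] does at least as well as [p0]; by [key] this persists at [t0], where
   [p0] dominates every [r]. *)
move=> q [_ /(_ p0 I)]; rewrite hopf_ge// => /(key q).2 qG; split=> // r _.
by apply: le_trans (p0_max r I) _; rewrite hopf_ge.
Qed.
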